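(* Let $\mathbf{k}$ be a field of characteristic zero. Then the integro-differential Weyl algebra is isomorphic to the ring of differential Rota-Baxter operators (of weight zero) with polynomial coefficients: $\mathrm{A}_1(\partial,\ell)\cong\mathbf{k}[x][\partial,\oint]$ as $\mathbf{k}$-algebras.
   Context: For a $\mathbf{k}$-algebra $A$ (not necessarily commutative or a domain) with derivation $\delta\colon A\to A$, the skew polynomial ring $A[\xi;\delta]$ is the free left $A$-module $\bigoplus_{n\ge0}A\xi^n$ with multiplication extending that of $A$ via $\xi a=a\xi+\delta(a)$. Let $\mathbf{k}[\partial,\ell]:=\mathbf{k}\langle D,L\rangle/(DL-1)$, with $\partial,\ell$ the residue classes of $D,L$ (so $\partial\ell=1$), and let $\delta$ be the unique derivation of $\mathbf{k}[\partial,\ell]$ with $\delta(\partial)=-1$ and $\delta(\ell)=\ell^2$. The integro-differential Weyl algebra is $\mathrm{A}_1(\partial,\ell):=\mathbf{k}[\partial,\ell][x;\delta]$. The polynomial ring $\mathbf{k}[x]$ is a differential Rota-Baxter algebra of weight zero with $\partial=d/dx$ and the standard Rota-Baxter operator $\oint\colon x^k\mapsto x^{k+1}/(k+1)$. Its ring of differential Rota-Baxter operators $\mathbf{k}[x][\partial,\oint]$ is the quotient of the free product $\mathbf{k}[x]*\mathbf{k}\langle\partial,\oint\rangle$ by the two-sided ideal generated by $\partial f-f\partial-f'$, $\ \oint f\oint-f^{\backprime}\oint+\oint f^{\backprime}$ (for all $f\in\mathbf{k}[x]$) and $\partial\oint-1$, where $f'=df/dx\in\mathbf{k}[x]$ and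 $f^{\backprime}\in\mathbf{k}[x]$ is the image of $f$ under the standard Rota-Baxter operator; juxtaposition in relators is the product in the free product. *)

(* Defs.v *)
From HB Require Import structures.
From mathcomp Require Import all_boot all_algebra finmap.
From mathcomp Require Import boolp.
From mathcomp Require Import monalg.

Set Implicit Arguments.
Unset Strict Implicit.
Unset Printing Implicit Defensive.

Import GRing.Theory.
Local Open Scope ring_scope.
Local Open Scope quotient_scope.

(* The quotient of a k-algebra by the two-sided ideal generated by P.
   MathComp's algType excludes the zero ring, and such a quotient may vanish,
   so it is a priori only a pzRingType and an lmodType over k (with the
   compatibility laws quot_scalerAl and quot_scalerAr). *)
Section Quotient.
Variables (k : pzRingType) (A : algType k) (P : A -> Prop).

Inductive ideal_gen : A -> Prop :=
| ideal_gen0 : ideal_gen 0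
| ideal_genD u v : ideal_gen u -> ideal_gen v -> ideal_gen (u + v)
| ideal_gen_mul a r b : P r -> ideal_gen (a * r * b).

Definition ideal_pred : {pred A} := fun u => `[< ideal_gen u >].

Lemma ideal_predP u : reflect (ideal_gen u) (u \in ideal_pred).
Proof. exact: asboolP. Qed.

Lemma ideal_genM a b u : ideal_gen u -> ideal_gen (a * u * b).
Proof.
elim=> [|u' v' _ IHu _ IHv|c r d Pr].
- by rewrite mulr0 mul0r; apply: ideal_gen0.
- by rewrite mulrDr mulrDl; apply: ideal_genD.
- by rewrite !mulrA -(mulrA _ d b); apply: ideal_gen_mul.
Qed.

Lemma ideal_genMl a u : ideal_gen u -> ideal_gen (a * u).
Proof. by move/(ideal_genM a 1); rewrite mulr1. Qed.

Lemma ideal_genMr b u : ideal_gen u -> ideal_gen (u * b).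
Proof. by move/(ideal_genM 1 b); rewrite mul1r. Qed.

Lemma ideal_pred_zmod_closed : zmod_closed ideal_pred.
Proof.
split=> [|u v /ideal_predP Iu /ideal_predP Iv]; apply/ideal_predP.
  exact: ideal_gen0.
by apply: ideal_genD => //; rewrite -mulN1r; apply: ideal_genMl.
Qed.

HB.instance Definition _ :=
  GRing.isZmodClosed.Build A ideal_pred ideal_pred_zmod_closed.

Definition quot_alg : Type := Quotient.quot ideal_pred.

HB.instance Definition _ := GRing.Zmodule.on quot_alg.
HB.instance Definition _ := EqQuotient.on quot_alg.

Definition qpi (u : A) : quot_alg := \pi_quot_alg u.

Lemma qpi_eq u v : qpi u = qpi v <-> ideal_gen (u - v).
Proof.
have idE := Quotient.idealrBE ideal_pred u v.
split=> [/eqP uv|/ideal_predP]; first by apply/ideal_predP; rewrite idE.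
by rewrite idE => /eqP.
Qed.

Lemma qpi_repr (x : quot_alg) : qpi (repr x) = x.
Proof. exact: reprK. Qed.

Lemma qpi_ind (T : quot_alg -> Prop) : (forall u, T (qpi u)) -> forall x, T x.
Proof. by move=> Tpi x; rewrite -(qpi_repr x). Qed.

Lemma repr_qpi u : ideal_gen (repr (qpi u) - u).
Proof. by apply/qpi_eq; rewrite qpi_repr. Qed.

Lemma qpi_is_zmod_morphism : zmod_morphism qpi.
Proof. by move=> u v; rewrite /qpi piE. Qed.

HB.instance Definition _ :=
  GRing.isZmodMorphism.Build A quot_alg qpi qpi_is_zmod_morphism.

Definition quot_one : quot_alg := qpi 1.
Definition quot_mul (x y : quot_alg) : quot_alg := qpi (repr x * repr y).
Definition quot_scale (c : k) (x : quot_alg) : quot_alg := qpi (c *: repr x).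

Lemma quot_mulE u v : quot_mul (qpi u) (qpi v) = qpi (u * v).
Proof.
apply/qpi_eq; set u' := repr _; set v' := repr _.
have -> : u' * v' - u * v = (u' - u) * v' + u * (v' - v).
  by rewrite mulrBl mulrBr addrA subrK.
by apply: ideal_genD; [apply: ideal_genMr|apply: ideal_genMl]; apply: repr_qpi.
Qed.

Lemma quot_scaleE c u : quot_scale c (qpi u) = qpi (c *: u).
Proof.
apply/qpi_eq; rewrite -scalerBr -[_ - _]mul1r scalerAl.
exact/ideal_genMl/repr_qpi.
Qed.

Fact quot_mulA : associative quot_mul.
Proof.
elim/qpi_ind=> u; elim/qpi_ind=> v; elim/qpi_ind=> w.
by rewrite !quot_mulE mulrA.
Qed.
Fact quot_mul1x : left_id quot_one quot_mul.
Proof. by elim/qpi_ind=> u; rewrite quot_mulE mul1r. Qed.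
Fact quot_mulx1 : right_id quot_one quot_mul.
Proof. by elim/qpi_ind=> u; rewrite quot_mulE mulr1. Qed.
Fact quot_mulDl : left_distributive quot_mul +%R.
Proof.
elim/qpi_ind=> u; elim/qpi_ind=> v; elim/qpi_ind=> w.
by rewrite -raddfD !quot_mulE mulrDl raddfD.
Qed.
Fact quot_mulDr : right_distributive quot_mul +%R.
Proof.
elim/qpi_ind=> u; elim/qpi_ind=> v; elim/qpi_ind=> w.
by rewrite -raddfD !quot_mulE mulrDr raddfD.
Qed.

HB.instance Definition _ := GRing.Zmodule_isPzRing.Build quot_alg
  quot_mulA quot_mul1x quot_mulx1 quot_mulDl quot_mulDr.

Fact quot_scaleA a b x : quot_scale a (quot_scale b x) = quot_scale (a * b) x.
Proof. by elim/qpi_ind: x => u; rewrite !quot_scaleE scalerA. Qed.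
Fact quot_scale1 : left_id 1 quot_scale.
Proof. by elim/qpi_ind=> u; rewrite quot_scaleE scale1r. Qed.
Fact quot_scaleDr : right_distributive quot_scale +%R.
Proof.
move=> a; elim/qpi_ind=> u; elim/qpi_ind=> v.
by rewrite -raddfD !quot_scaleE scalerDr raddfD.
Qed.
Fact quot_scaleDl x : {morph quot_scale^~ x : a b / a + b}.
Proof. by elim/qpi_ind: x => u a b; rewrite !quot_scaleE scalerDl raddfD. Qed.

HB.instance Definition _ := GRing.Zmodule_isLmodule.Build k quot_alg
  quot_scaleA quot_scale1 quot_scaleDr quot_scaleDl.

Lemma qpi_is_monoid_morphism : monoid_morphism qpi.
Proof. by split=> // u v; rewrite -quot_mulE. Qed.
Lemma qpi_is_scalable : scalable qpi.
Proof. by move=> c u; rewrite -quot_scaleE. Qed.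

HB.instance Definition _ :=
  GRing.isMonoidMorphism.Build A quot_alg qpi qpi_is_monoid_morphism.
HB.instance Definition _ :=
  GRing.isScalable.Build k A quot_alg *:%R qpi qpi_is_scalable.

Fact quot_scalerAl (c : k) (x y : quot_alg) : c *: (x * y) = (c *: x) * y.
Proof.
elim/qpi_ind: x => u; elim/qpi_ind: y => v.
by rewrite -rmorphM -!linearZ -rmorphM scalerAl.
Qed.
Fact quot_scalerAr (c : k) (x y : quot_alg) : c *: (x * y) = x * (c *: y).
Proof.
elim/qpi_ind: x => u; elim/qpi_ind: y => v.
by rewrite -rmorphM -!linearZ -rmorphM scalerAr.
Qed.

Lemma quot_alg_nonzero (B : nzRingType) (f : {rmorphism A -> B}) :
  (forall r, P r -> f r = 0) -> 1 != 0 :> quot_alg.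
Proof.
move=> fP; have fI u : ideal_gen u -> f u = 0.
  elim=> [|v w _ fv _ fw|a r b /fP fr]; first exact: rmorph0.
    by rewrite rmorphD fv fw addr0.
  by rewrite !rmorphM fr mulr0 mul0r.
apply/eqP; rewrite -(rmorph0 qpi) => /qpi_eq/fI/eqP.
by rewrite subr0 rmorph1 oner_eq0.
Qed.

End Quotient.

Arguments quot_alg {k A} P.
Arguments qpi {k A} P u.

(* The free algebra k<X>, i.e., the algebra of the free monoid on X.  Product
   and scaling are those of {malg k[{fmonom X}]}, locked since comparing them
   by unfolding is prohibitively slow. *)
Definition free_alg (k : comNzRingType) (X : choiceType) : Type :=
  {malg k[{fmonom X}]}.

HB.lock Definition free_mul (k : comNzRingType) (X : choiceType)
  (u v : {malg k[{fmonom X}]}) : {malg k[{fmonom X}]} := u * v.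

HB.lock Definition free_scale (k : comNzRingType) (X : choiceType)
  (c : k) (u : {malg k[{fmonom X}]}) : {malg k[{fmonom X}]} := c *: u.

Section FreeAlgebra.
Variables (k : comNzRingType) (X : choiceType).

Local Notation malgX := {malg k[{fmonom X}]}.
Local Notation free_mul := (@free_mul k X).
Local Notation free_scale := (@free_scale k X).

Lemma free_mulE u v : free_mul u v = u * v.
Proof. by rewrite free_mul.unlock. Qed.

Lemma free_scaleE c u : free_scale c u = c *: u.
Proof. by rewrite free_scale.unlock. Qed.

HB.instance Definition _ := GRing.Zmodule.on (free_alg k X).

Fact free_mulA : associative free_mul.
Proof. by move=> u v w; rewrite !free_mulE mulrA. Qed.
Fact free_mul1u : left_id (1 : malgX) free_mul.
Proof. by move=> u; rewrite free_mulE mul1r. Qed.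
Fact free_mulu1 : right_id (1 : malgX) free_mul.
Proof. by move=> u; rewrite free_mulE mulr1. Qed.
Fact free_mulDl : left_distributive free_mul +%R.
Proof. by move=> u v w; rewrite !free_mulE mulrDl. Qed.
Fact free_mulDr : right_distributive free_mul +%R.
Proof. by move=> u v w; rewrite !free_mulE mulrDr. Qed.

HB.instance Definition _ := GRing.Zmodule_isNzRing.Build (free_alg k X)
  free_mulA free_mul1u free_mulu1 free_mulDl free_mulDr (oner_neq0 malgX).

Fact free_scaleA a b u : free_scale a (free_scale b u) = free_scale (a * b) u.
Proof. by rewrite !free_scaleE scalerA. Qed.
Fact free_scale1 : left_id 1 free_scale.
Proof. by move=> u; rewrite free_scaleE scale1r. Qed.
Fact free_scaleDr : right_distributive free_scale +%R.
Proof. by move=> a u v; rewrite !free_scaleE scalerDr. Qed.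
Fact free_scaleDl u : {morph free_scale^~ u : a b / a + b}.
Proof. by move=> a b; rewrite !free_scaleE scalerDl. Qed.

HB.instance Definition _ := GRing.Zmodule_isLmodule.Build k (free_alg k X)
  free_scaleA free_scale1 free_scaleDr free_scaleDl.

Fact free_scalerAl (c : k) (u v : free_alg k X) : c *: (u * v) = (c *: u) * v.
Proof.
change (free_scale c (free_mul u v) = free_mul (free_scale c u) v).
by rewrite !free_mulE !free_scaleE -scalerAl.
Qed.

HB.instance Definition _ :=
  GRing.Lmodule_isLalgebra.Build k (free_alg k X) free_scalerAl.

Fact free_scalerAr (c : k) (u v : free_alg k X) : c *: (u * v) = u * (c *: v).
Proof.
change (free_scale c (free_mul u v) = free_mul u (free_scale c v)).
rewrite !free_mulE !free_scaleE -!mul_malgC.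
have cC w : c%:MP * w = w * c%:MP :> malgX.
  apply/malgP=> m; rewrite [in LHS]malgM_def [in RHS]malgM_def.
  rewrite fgmulUg fgmulgU !raddf_sum /=.
  by apply: eq_bigr => i _; rewrite mul1m mulm1 mulrC.
by rewrite mulrA cC -mulrA.
Qed.

HB.instance Definition _ :=
  GRing.Lalgebra_isAlgebra.Build k (free_alg k X) free_scalerAr.

Definition free_gen (x : X) : free_alg k X := << fmu x >>.
Definition free_word (w : {fmonom X}) : free_alg k X := << w >>.

Lemma free_word1 : free_word mone = 1.
Proof. by []. Qed.

Lemma free_wordM v w : free_word (mmul v w) = free_word v * free_word w.
Proof. by rewrite [RHS]free_mulE malgM_def fgmulUU mulr1. Qed.

Lemma free_word_prod w : free_word w = \prod_(x <- (w : seq X)) free_gen x.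
Proof.
case: w => s /=; elim: s => [|x s IHs].
  by rewrite big_nil -free_word1 -[mone]fmK fm1.
by rewrite big_cons -IHs /free_gen -free_wordM -[mmul _ _]fmK fmM fmU.
Qed.

Lemma free_coeffZ c (u : free_alg k X) w : (c *: u)@_w = c * u@_w.
Proof. by rewrite [_ *: _]free_scaleE mcoeffZ. Qed.

Lemma free_wordE (u : free_alg k X) :
  u = \sum_(w <- msupp u) u@_w *: free_word w.
Proof.
rewrite {1}[u]monalgE; apply: eq_bigr => w _.
by apply/malgP=> m; rewrite free_coeffZ !mcoeffU mulr_natr.
Qed.

Section LinearExtension.
Variables (V : lmodType k) (h : {fmonom X} -> V).

Definition free_ext (u : free_alg k X) : V := \sum_(w <- msupp u) u@_w *: h w.

Lemma free_ext_is_linear : linear free_ext.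
Proof.
have ext_widen (d : {fset {fmonom X}}) (u : free_alg k X) :
    (msupp u `<=` d)%fset -> free_ext u = \sum_(w <- d) u@_w *: h w.
  move=> le_ud; rewrite /free_ext (big_fset_incl _ le_ud) //= => w _.
  by move/mcoeff_outdom->; rewrite scale0r.
move=> c u v; pose d := (msupp u `|` msupp v `|` msupp (c *: u + v))%fset.
rewrite !(ext_widen d) /d; try by apply/fsubsetP=> w; rewrite !inE => ->; rewrite ?orbT.
rewrite scaler_sumr -big_split /=; apply: eq_bigr => w _.
by rewrite mcoeffD free_coeffZ scalerDl scalerA.
Qed.

HB.instance Definition _ :=
  GRing.isLinear.Build k (free_alg k X) V *:%R free_ext free_ext_is_linear.

Lemma free_ext_word w : free_ext (free_word w) = h w.
Proof. by rewrite /free_ext msuppU1 big_seq_fset1 mcoeffUU scale1r. Qed.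
End LinearExtension.

Lemma free_ind (T : free_alg k X -> Prop) :
  T 0 -> (forall c u v, T u -> T v -> T (c *: u + v)) ->
  (forall s, T (free_word (FMonom s))) -> forall u, T u.
Proof.
move=> T0 TD Tw u; rewrite [u]free_wordE.
by elim/big_rec: _ => [|[s] v _]; [exact: T0|apply: TD].
Qed.

Lemma free_word_nil : free_word (FMonom [::]) = 1.
Proof. by rewrite free_word_prod big_nil. Qed.

Lemma free_word_cons x s :
  free_word (FMonom (x :: s)) = free_gen x * free_word (FMonom s).
Proof. by rewrite !free_word_prod big_cons. Qed.

Lemma free_word_cat s t :
  free_word (FMonom (s ++ t)) = free_word (FMonom s) * free_word (FMonom t).
Proof. by rewrite !free_word_prod big_cat. Qed.

(* The algebra morphism extending f : X -> B. *)
Section Lift.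
Variables (B : algType k) (f : X -> B).

Definition free_lift : free_alg k X -> B :=
  free_ext (fun w => \prod_(x <- (w : seq X)) f x).

Lemma free_lift_linear : linear free_lift.
Proof. exact: free_ext_is_linear. Qed.

HB.instance Definition _ := GRing.Linear.on free_lift.

Lemma free_lift_word s : free_lift (free_word (FMonom s)) = \prod_(x <- s) f x.
Proof. exact: free_ext_word. Qed.

Lemma free_lift_gen x : free_lift (free_gen x) = f x.
Proof. by rewrite [LHS]free_ext_word fmU big_seq1. Qed.

Lemma free_lift_is_monoid_morphism : monoid_morphism free_lift.
Proof.
split=> [|u v]; first by rewrite -free_word_nil free_lift_word big_nil.
elim/free_ind: u => [|c u u' IHu IHu'|s]; first by rewrite mul0r !linear0 mul0r.
  rewrite free_lift_linear [RHS]mulrDl -[X in _ = X + _]scalerAl -IHu -IHu'.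
  by rewrite mulrDl -scalerAl free_lift_linear.
elim/free_ind: v => [|c v v' IHv IHv'|t]; first by rewrite mulr0 !linear0 mulr0.
  rewrite free_lift_linear [RHS]mulrDr -[X in _ = X + _]scalerAr -IHv -IHv'.
  by rewrite mulrDr -scalerAr free_lift_linear.
by rewrite -free_word_cat !free_lift_word big_cat.
Qed.

HB.instance Definition _ := GRing.isMonoidMorphism.Build (free_alg k X) B
  free_lift free_lift_is_monoid_morphism.
End Lift.

End FreeAlgebra.

Record derivation (k : pzRingType) (A : algType k) := Derivation {
  der_fun :> {linear A -> A};
  der_leibniz : forall a b, der_fun (a * b) = der_fun a * b + a * der_fun b
}.

Section DerivationTheory.
Variables (k : pzRingType) (A : algType k) (d : derivation A).

Lemma der1 : d 1 = 0.
Proof.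
have := der_leibniz d 1 1; rewrite !mulr1 mul1r => /eqP.
by rewrite -subr_eq subrr => /eqP.
Qed.

Lemma der_alg c : d c%:A = 0.
Proof. by rewrite linearZ /= der1 scaler0. Qed.
End DerivationTheory.

(* The derivation of k<X> extending f : X -> k<X>. *)
Section FreeDerivation.
Variables (k : comNzRingType) (X : choiceType) (f : X -> free_alg k X).

Fixpoint word_der (s : seq X) : free_alg k X :=
  if s is x :: s' then
    f x * free_word k (FMonom s') + free_gen k x * word_der s'
  else 0.

Definition free_der : free_alg k X -> free_alg k X :=
  free_ext (fun w => word_der w).

Lemma free_der_linear : linear free_der.
Proof. exact: free_ext_is_linear. Qed.

HB.instance Definition _ := GRing.Linear.on free_der.

Lemma free_der_word s : free_der (free_word k (FMonom s)) = word_der s.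
Proof. exact: free_ext_word. Qed.

Lemma free_der_gen x : free_der (free_gen k x) = f x.
Proof. by rewrite [LHS]free_ext_word fmU /= free_word_nil mulr0 addr0 mulr1. Qed.

Lemma free_der_leibniz u v : free_der (u * v) = free_der u * v + u * free_der v.
Proof.
elim/free_ind: u => [|c u u' IHu IHu'|s].
- by rewrite !mul0r !linear0 mul0r addr0.
- rewrite mulrDl -scalerAl !free_der_linear.
  transitivity (c *: (free_der u * v + u * free_der v)
                + (free_der u' * v + u' * free_der v)).
    exact: (f_equal2 (fun x y => c *: x + y) IHu IHu').
  move: (free_der u) (free_der u') (free_der v) => du du' dv.
  by rewrite !mulrDl scalerDr !scalerAl addrACA.
elim/free_ind: v => [|c v v' IHv IHv'|t].
- by rewrite !mulr0 !linear0 mulr0 addr0.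
- rewrite mulrDr -scalerAr !free_der_linear; set w := free_word _ _.
  transitivity (c *: (free_der w * v + w * free_der v)
                + (free_der w * v' + w * free_der v')).
    exact: (f_equal2 (fun x y => c *: x + y) IHv IHv').
  move: (free_der w) (free_der v) (free_der v') => dw dv dv'.
  by rewrite !mulrDr scalerDr !scalerAr addrACA.
rewrite -free_word_cat !free_der_word; elim: s => [|x s IHs] /=.
  by rewrite free_word_nil mul0r mul1r add0r.
by rewrite IHs free_word_cat free_word_cons !mulrDr !mulrDl !mulrA addrA.
Qed.
End FreeDerivation.

(* The skew polynomial ring A[xi; d] is carried by the free left A-module
   {poly A}, the n-th coefficient of p being that of xi^n; only its product
   differs from that of {poly A}.  As a left multiplication, xi is
     sum_j b_j xi^j  |-->  sum_j (b_j xi + d b_j) xi^j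
   by the rule xi * b = b * xi + d b, and
     (sum_i a_i xi^i) * q = sum_i a_i (xi^i q).  *)
Definition skew_poly (k : pzRingType) (A : algType k) (d : derivation A) : Type :=
  {poly A}.

Section SkewPoly.
Variables (k : pzRingType) (A : algType k) (d : derivation A).

Local Notation skew_poly := (skew_poly d).

HB.instance Definition _ := GRing.Zmodule.on skew_poly.

Implicit Types p q r : {poly A}.

Definition skew_shift q : {poly A} := q * 'X + map_poly d q.

Definition skew_mul (p q : skew_poly) : skew_poly :=
  \sum_(i < size (p : {poly A})) (p : {poly A})`_i *: iter i skew_shift q.

Definition skew_const (a : A) : skew_poly := a%:P.
Definition skew_xi : skew_poly := ('X : {poly A}).

Definition skew_scale (c : k) (p : skew_poly) : skew_poly :=
  c%:A *: (p : {poly A}).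

Lemma skew_shift_is_zmod_morphism : zmod_morphism skew_shift.
Proof. by move=> p q; rewrite /skew_shift raddfB mulrBl opprD addrACA. Qed.
HB.instance Definition _ := GRing.isZmodMorphism.Build {poly A} {poly A}
  skew_shift skew_shift_is_zmod_morphism.

Lemma skew_shiftZ a q : skew_shift (a *: q) = a *: skew_shift q + d a *: q.
Proof.
rewrite /skew_shift -scalerAl scalerDr -addrA; congr (_ + _).
apply/polyP=> i; rewrite !(coefD, coefZ) !coef_map_id0 ?linear0 //.
by rewrite coefZ der_leibniz addrC.
Qed.

Lemma iter_shiftD i p q :
  iter i skew_shift (p + q) = iter i skew_shift p + iter i skew_shift q.
Proof. by elim: i => // i IHi; rewrite iterS IHi [LHS]raddfD. Qed.

Lemma skew_mulEw n p q : (size p <= n)%N ->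
  skew_mul p q = \sum_(i < n) p`_i *: iter i skew_shift q.
Proof.
move=> le_pn; rewrite /skew_mul.
rewrite (big_ord_widen n (fun i => p`_i *: iter i skew_shift q) le_pn).
rewrite big_mkcond; apply: eq_bigr => i _; case: ltnP => // /(nth_default 0) ->.
by rewrite scale0r.
Qed.

Lemma skew_mulDl p q r : skew_mul (p + q) r = skew_mul p r + skew_mul q r.
Proof.
pose n := maxn (size (p + q)) (maxn (size p) (size q)).
rewrite !(@skew_mulEw n) /n ?leq_max ?leqnn ?orbT // -big_split.
by apply: eq_bigr => i _; rewrite coefD scalerDl.
Qed.

Lemma skew_mulDr p q r : skew_mul p (q + r) = skew_mul p q + skew_mul p r.
Proof. by rewrite -big_split; apply: eq_bigr => i _; rewrite iter_shiftD scalerDr. Qed.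

Lemma skew_mulZl a p q : skew_mul (a *: p) q = a *: skew_mul p q.
Proof.
rewrite (@skew_mulEw (size p)) ?size_scale_leq // scaler_sumr.
by apply: eq_bigr => i _; rewrite coefZ scalerA.
Qed.

Lemma skew_mul_shiftl p q : skew_mul (skew_shift p) q = skew_shift (skew_mul p q).
Proof.
rewrite skew_mulDl raddf_sum.
rewrite (@skew_mulEw (size p).+1); last first.
  by case: (eqVneq p 0) => [->|p0]; rewrite ?mul0r ?size_poly0 ?size_mulX.
rewrite big_ord_recl coefMX scale0r add0r.
rewrite (@skew_mulEw (size p) (map_poly d p)) ?size_poly // -big_split.
apply: eq_bigr => i _; rewrite /= skew_shiftZ coefMX /=.
by rewrite coef_map_id0 ?linear0.
Qed.

Fact skew_mulA : associative skew_mul.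
Proof.
move=> p q r.
have mul0 : skew_mul (0 : {poly A}) r = 0.
  by rewrite /skew_mul size_poly0 big_ord0.
rewrite [skew_mul p q]/skew_mul.
rewrite (big_morph (fun p' => skew_mul p' r) (fun x y => skew_mulDl x y r) mul0).
apply: eq_bigr => i _; rewrite skew_mulZl; congr (_ *: _).
by elim: {i}(i : nat) => //= i ->; rewrite skew_mul_shiftl.
Qed.
Fact skew_mul1p : left_id (skew_const 1) skew_mul.
Proof. by move=> p; rewrite /skew_mul size_poly1 big_ord1 coefC scale1r. Qed.
Fact skew_mulp1 : right_id (skew_const 1) skew_mul.
Proof.
move=> p; rewrite /skew_mul -[RHS]coefK poly_def; apply: eq_bigr => i _.
congr (_ *: _); elim: {i}(i : nat) => //= i ->.
rewrite /skew_shift -exprSr; apply/polyP=> j.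
rewrite coefD coef_map_id0 ?linear0 // !coefXn.
by case: (j == i); rewrite ?mulr1n ?mulr0n ?der1 ?linear0 addr0.
Qed.
Fact skew_one_neq0 : skew_const 1 != 0.
Proof. exact: oner_neq0. Qed.

HB.instance Definition _ := GRing.Zmodule_isNzRing.Build skew_poly
  skew_mulA skew_mul1p skew_mulp1 skew_mulDl skew_mulDr skew_one_neq0.

Fact skew_scaleA a b p : skew_scale a (skew_scale b p) = skew_scale (a * b) p.
Proof.
have abA : a%:A * b%:A = (a * b)%:A :> A by rewrite mulr_algl scalerA.
by rewrite /skew_scale scalerA; congr (_ *: _); exact: abA.
Qed.
Fact skew_scale1 : left_id 1 skew_scale.
Proof. by move=> p; rewrite /skew_scale !scale1r. Qed.
Fact skew_scaleDr : right_distributive skew_scale +%R.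
Proof. by move=> a p q; rewrite /skew_scale scalerDr. Qed.
Fact skew_scaleDl p : {morph skew_scale^~ p : a b / a + b}.
Proof. by move=> a b; rewrite /skew_scale !scalerDl. Qed.

HB.instance Definition _ := GRing.Zmodule_isLmodule.Build k skew_poly
  skew_scaleA skew_scale1 skew_scaleDr skew_scaleDl.

Fact skew_scalerAl (c : k) (p q : skew_poly) : c *: (p * q) = (c *: p) * q.
Proof. by rewrite [RHS]skew_mulZl. Qed.

HB.instance Definition _ :=
  GRing.Lmodule_isLalgebra.Build k skew_poly skew_scalerAl.

Fact skew_scalerAr (c : k) (p q : skew_poly) : c *: (p * q) = p * (c *: q).
Proof.
have iterZ i : iter i skew_shift (c%:A *: (q : {poly A})) =
    c%:A *: iter i skew_shift q.
  by elim: i => //= i ->; rewrite skew_shiftZ der_alg scale0r addr0.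
rewrite [LHS]scaler_sumr; apply: eq_bigr => i _.
pose r := iter i skew_shift q.
change (c%:A *: ((p : {poly A})`_i *: r)
        = (p : {poly A})`_i *: iter i skew_shift (c%:A *: (q : {poly A}))).
rewrite iterZ !scalerA; congr (_ *: _).
have cA a : c%:A * a = a * c%:A :> A by rewrite mulr_algl mulr_algr.
exact: cA.
Qed.

HB.instance Definition _ :=
  GRing.Lalgebra_isAlgebra.Build k skew_poly skew_scalerAr.

Lemma skew_mulC a (q : skew_poly) : skew_const a * q = a *: (q : {poly A}).
Proof.
by rewrite [LHS](@skew_mulEw 1) ?size_polyC_leq1 // big_ord1 coefC.
Qed.

Lemma skew_mulX (q : skew_poly) : skew_xi * q = skew_shift q.
Proof.
rewrite [LHS](@skew_mulEw 2) ?size_polyX // !big_ord_recr big_ord0 /=.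
by rewrite !coefX scale0r scale1r !add0r.
Qed.

Lemma skew_xi_const a :
  skew_xi * skew_const a = skew_const a * skew_xi + skew_const (d a).
Proof.
rewrite skew_mulX skew_mulC /skew_shift mul_polyC /skew_const; congr (_ + _).
by apply: map_polyC.
Qed.

Lemma skew_const_is_zmod_morphism : zmod_morphism skew_const.
Proof. by move=> a b; rewrite /skew_const raddfB. Qed.
Lemma skew_const_is_monoid_morphism : monoid_morphism skew_const.
Proof.
by split=> // a b; rewrite skew_mulC /skew_const polyCM mul_polyC.
Qed.
Lemma skew_const_is_scalable : scalable skew_const.
Proof.
move=> c a; rewrite [RHS]/GRing.scale /= /skew_scale /skew_const -mul_polyC.
by rewrite -polyCM -scalerAl mul1r.
Qed.
HB.instance Definition _ :=
  GRing.isZmodMorphism.Build A skew_poly skew_const skew_const_is_zmod_morphism.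
HB.instance Definition _ := GRing.isMonoidMorphism.Build A skew_poly
  skew_const skew_const_is_monoid_morphism.
HB.instance Definition _ := GRing.isScalable.Build k A skew_poly *:%R
  skew_const skew_const_is_scalable.

Lemma skew_polyE (p : skew_poly) :
  p = \sum_(i < size (p : {poly A})) skew_const (p : {poly A})`_i * skew_xi ^+ i.
Proof.
have xiX i : skew_xi ^+ i = 'X^i :> {poly A}.
  elim: i => // i IHi; rewrite exprS skew_mulX IHi /skew_shift -exprSr.
  rewrite -[RHS]addr0; congr (_ + _); apply/polyP=> j.
  by rewrite coef_map_id0 ?linear0 // coefXn coef0;
  case: (j == i); rewrite ?mulr1n ?mulr0n ?der1 ?linear0.
rewrite {1}[p](esym (coefK _)) poly_def; apply: eq_bigr => i _.
by rewrite skew_mulC xiX.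
Qed.
End SkewPoly.

(* k[d, l] = k<D, L> / (D L - 1), with D, L the free generators 0 and 1 and
   partial, ell their residue classes d, l. *)
Section IntDiffAlg.
Variable k : comNzRingType.

Let D : free_alg k 'I_2 := free_gen k ord0.
Let L : free_alg k 'I_2 := free_gen k ord_max.

Variant int_diff_rel : free_alg k 'I_2 -> Prop :=
| IntDiffRel : int_diff_rel (D * L - 1).

Definition int_diff_alg : Type := quot_alg int_diff_rel.

HB.instance Definition _ := GRing.PzRing.on int_diff_alg.
HB.instance Definition _ := GRing.Lmodule.on int_diff_alg.

Fact int_diff_nonzero : 1 != 0 :> int_diff_alg.
Proof.
pose f : {rmorphism _ -> k^o} := free_lift (fun _ : 'I_2 => 1 : k^o).
have fE i : f (free_gen k i) = 1 by exact: free_lift_gen.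
apply: (@quot_alg_nonzero _ _ _ _ f) => _ [].
by rewrite rmorphB rmorphM rmorph1 !fE mulr1 subrr.
Qed.

HB.instance Definition _ :=
  GRing.PzSemiRing_isNonZero.Build int_diff_alg int_diff_nonzero.
HB.instance Definition _ :=
  GRing.Lmodule_isLalgebra.Build k int_diff_alg
    (@quot_scalerAl _ _ int_diff_rel).
HB.instance Definition _ :=
  GRing.Lalgebra_isAlgebra.Build k int_diff_alg
    (@quot_scalerAr _ _ int_diff_rel).

Definition partial : int_diff_alg := qpi int_diff_rel D.
Definition ell : int_diff_alg := qpi int_diff_rel L.

Lemma partial_ell : partial * ell = 1.
Proof.
rewrite /partial /ell -rmorphM -[RHS](rmorph1 (qpi int_diff_rel)).
apply/qpi_eq; rewrite -[_ - _]mul1r -[_ * _]mulr1.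
exact/ideal_gen_mul/IntDiffRel.
Qed.

(* The derivation of k<D, L> with D |-> -1 and L |-> L^2. *)
Definition free_delta : free_alg k 'I_2 -> free_alg k 'I_2 :=
  free_der (fun i => if i == ord0 then - 1 else L ^+ 2).

HB.instance Definition _ := GRing.Linear.on free_delta.

Lemma free_delta_ideal u :
  ideal_gen int_diff_rel u -> ideal_gen int_diff_rel (free_delta u).
Proof.
have delta_rel : free_delta (D * L - 1) = (D * L - 1) * L.
  have deltaM v w : free_delta (v * w) = free_delta v * w + v * free_delta w.
    exact: free_der_leibniz.
  have delta1 : free_delta 1 = 0.
    have /eqP := deltaM 1 1; rewrite !mulr1 mul1r.
    by rewrite -subr_eq subrr => /eqP.
  rewrite raddfB /= delta1 subr0 deltaM [free_delta D]free_der_gen.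
  rewrite [free_delta L]free_der_gen /= expr2 mulN1r mulrA mulrBl mul1r.
  by rewrite addrC.
elim=> [|v w _ IHv _ IHw|a r b [] {r}].
- by rewrite raddf0; apply: ideal_gen0.
- by rewrite raddfD; apply: ideal_genD.
set r := D * L - 1; have Ir : ideal_gen int_diff_rel r.
  rewrite -[r]mul1r -[_ * _]mulr1; exact/ideal_gen_mul/IntDiffRel.
rewrite [free_delta _]free_der_leibniz.
rewrite [free_der _ (a * r)]free_der_leibniz mulrDl -!/(free_delta _).
rewrite [free_delta r]delta_rel.
apply: ideal_genD; last exact/ideal_genMr/ideal_genMl.
apply: ideal_genD; apply: ideal_genMr; apply: ideal_genMl => //.
exact: ideal_genMr.
Qed.

Definition delta_fun (x : int_diff_alg) : int_diff_alg :=
  qpi int_diff_rel (free_delta (repr x)).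

Lemma delta_qpi u :
  delta_fun (qpi int_diff_rel u) = qpi int_diff_rel (free_delta u).
Proof.
apply/qpi_eq; rewrite -raddfB; apply: free_delta_ideal; exact: repr_qpi.
Qed.

Lemma delta_is_linear : linear delta_fun.
Proof.
move=> c; elim/qpi_ind=> u; elim/qpi_ind=> v.
rewrite -linearP !delta_qpi -linearP; congr (qpi _ _).
exact: free_der_linear.
Qed.

HB.instance Definition _ := GRing.isLinear.Build k int_diff_alg int_diff_alg
  *:%R delta_fun delta_is_linear.

Lemma delta_leibniz x y : delta_fun (x * y) = delta_fun x * y + x * delta_fun y.
Proof.
elim/qpi_ind: x => u; elim/qpi_ind: y => v.
rewrite -rmorphM !delta_qpi -!rmorphM -rmorphD; congr (qpi _ _).
exact: free_der_leibniz.
Qed.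

Definition delta : derivation int_diff_alg := Derivation delta_leibniz.

Lemma delta_partial : delta partial = - 1.
Proof.
rewrite [LHS]delta_qpi [free_delta D]free_der_gen /= rmorphN.
by rewrite rmorph1.
Qed.

Lemma delta_ell : delta ell = ell ^+ 2.
Proof.
by rewrite [LHS]delta_qpi [free_delta L]free_der_gen /= rmorphXn.
Qed.

Lemma delta_unique (d : derivation int_diff_alg) :
  d partial = - 1 -> d ell = ell ^+ 2 -> d =1 delta.
Proof.
move=> dD dL; elim/qpi_ind; elim/free_ind=> [|c u v IHu IHv|w].
- by rewrite rmorph0 !linear0.
- by rewrite !linearP IHu IHv.
elim: w => [|i w IHw]; first by rewrite free_word_nil rmorph1 !der1.
rewrite free_word_cons rmorphM !der_leibniz IHw; congr (_ * _ + _).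
case: (eqVneq i ord0) => [->|i0]; first by rewrite [LHS]dD delta_partial.
have -> : i = ord_max by apply/val_inj; case: i i0 => [[|[]]].
by rewrite [LHS]dL delta_ell.
Qed.

End IntDiffAlg.

(* The variable of the integro-differential Weyl algebra is skew_xi (delta k). *)
Definition int_diff_weyl (k : comNzRingType) : Type := skew_poly (delta k).

HB.instance Definition _ (k : comNzRingType) := GRing.Algebra.on (int_diff_weyl k).

(* The free product (coproduct) of two algebras: the free algebra on their
   disjoint union, modulo the relations making both inclusions algebra
   morphisms. *)
Section FreeProduct.
Variables (k : comNzRingType) (A B : algType k).

Let inA (a : A) : free_alg k (A + B)%type := free_gen k (inl a).
Let inB (b : B) : free_alg k (A + B)%type := free_gen k (inr b).

Variant free_prod_rel : free_alg k (A + B)%type -> Prop :=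
| FreeProdLinl c a a' : free_prod_rel (inA (c *: a + a') - (c *: inA a + inA a'))
| FreeProdMull a a' : free_prod_rel (inA (a * a') - inA a * inA a')
| FreeProd1l : free_prod_rel (inA 1 - 1)
| FreeProdLinr c b b' : free_prod_rel (inB (c *: b + b') - (c *: inB b + inB b'))
| FreeProdMulr b b' : free_prod_rel (inB (b * b') - inB b * inB b')
| FreeProd1r : free_prod_rel (inB 1 - 1).

Definition free_prod : Type := quot_alg free_prod_rel.

HB.instance Definition _ := GRing.PzRing.on free_prod.
HB.instance Definition _ := GRing.Lmodule.on free_prod.

Definition free_prod_inl (a : A) : free_prod := qpi free_prod_rel (inA a).
Definition free_prod_inr (b : B) : free_prod := qpi free_prod_rel (inB b).

Lemma free_prod_nonzero (C : algType k)
  (f : {lrmorphism A -> C}) (g : {lrmorphism B -> C}) : 1 != 0 :> free_prod.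
Proof.
pose h0 (s : A + B) := match s with inl a => f a | inr b => g b end.
pose h : {rmorphism _ -> C} := free_lift h0.
have hA a : h (inA a) = f a by exact: free_lift_gen.
have hB b : h (inB b) = g b by exact: free_lift_gen.
have hP c u v : h (c *: u + v) = c *: h u + h v by exact: free_lift_linear.
have fP c u v : f (c *: u + v) = c *: f u + f v by exact: linearP.
have gP c u v : g (c *: u + v) = c *: g u + g v by exact: linearP.
apply: (@quot_alg_nonzero _ _ _ _ h) => r.
have hD u v : h (u - v) = h u - h v by exact: raddfB.
have hM u v : h (u * v) = h u * h v by exact: rmorphM.
have h1 : h 1 = 1 by exact: rmorph1.
case=> [c a a'|a a'||c b b'|b b'|]; rewrite hD.
- by rewrite hP !hA fP subrr.
- by rewrite hM !hA [f _]rmorphM subrr.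
- by rewrite hA h1 rmorph1 subrr.
- by rewrite hP !hB gP subrr.
- by rewrite hM !hB [g _]rmorphM subrr.
- by rewrite hB h1 rmorph1 subrr.
Qed.

End FreeProduct.

(* The standard Rota-Baxter operator x^n |-> x^(n+1) / (n+1) of k[x]. *)
Definition rota_baxter (k : fieldType) (f : {poly k}) : {poly k} :=
  \sum_(n < size f) (f`_n / n.+1%:R) *: 'X^(n.+1).

Section DiffRotaBaxter.
Variable k : fieldType.

(* The free product k[x] * k<d, I>, with d, I the free generators 0 and 1. *)
Definition rb_free_prod : Type := free_prod {poly k} (free_alg k 'I_2).

HB.instance Definition _ := GRing.PzRing.on rb_free_prod.
HB.instance Definition _ := GRing.Lmodule.on rb_free_prod.

Fact rb_free_prod_nonzero : 1 != 0 :> rb_free_prod.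
Proof.
pose f : {lrmorphism {poly k} -> k^o} := horner_eval (0 : k).
pose g : {lrmorphism free_alg k 'I_2 -> k^o} := free_lift (fun _ => 0).
exact: free_prod_nonzero f g.
Qed.

HB.instance Definition _ :=
  GRing.PzSemiRing_isNonZero.Build rb_free_prod rb_free_prod_nonzero.
HB.instance Definition _ := GRing.Lmodule_isLalgebra.Build k rb_free_prod
  (@quot_scalerAl _ _ (@free_prod_rel _ {poly k} (free_alg k 'I_2))).
HB.instance Definition _ := GRing.Lalgebra_isAlgebra.Build k rb_free_prod
  (@quot_scalerAr _ _ (@free_prod_rel _ {poly k} (free_alg k 'I_2))).

Let pol (f : {poly k}) : rb_free_prod := free_prod_inl (free_alg k 'I_2) f.
Let der : rb_free_prod := free_prod_inr {poly k} (free_gen k ord0).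
Let rbint : rb_free_prod := free_prod_inr {poly k} (free_gen k ord_max).

Variant diff_rb_rel : rb_free_prod -> Prop :=
| DiffRBLeibniz f : diff_rb_rel (der * pol f - pol f * der - pol f^`())
| DiffRBRotaBaxter f :
    diff_rb_rel (rbint * pol f * rbint - pol (rota_baxter f) * rbint
                 + rbint * pol (rota_baxter f))
| DiffRBSection : diff_rb_rel (der * rbint - 1).

Definition diff_rb_ops : Type := quot_alg diff_rb_rel.

HB.instance Definition _ := GRing.PzRing.on diff_rb_ops.
HB.instance Definition _ := GRing.Lmodule.on diff_rb_ops.

End DiffRotaBaxter.

(* Main.v *)
Require Import Defs.
From HB Require Import structures.
From mathcomp Require Import all_boot all_algebra.

Import GRing.Theory.
Local Open Scope ring_scope.

(** Both algebras are generated by a variable x, a derivation d and an integral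
    l, and in characteristic zero both are presented by the three relations
      d l = 1,   d x = x d + 1,   x l = l x + l^2.          (R)
    For the Weyl algebra this is its construction: a skew polynomial ring is
    universal for a commutation rule of its variable with the coefficients, and
    that rule propagates from generators to all of k[d, l]
    (int_diff_weyl_lift).

    For the ring of differential Rota-Baxter operators, the relations (R) are
    instances of the defining ones: the Leibniz relation at f = x gives the
    second and the Rota-Baxter relation at f = 1 gives the third.  Conversely
    (R) implies all of them.  The Leibniz relation extends from x to
    polynomials by induction (comm_hornerM).  The Rota-Baxter relation at x^n
    amounts to
      x^(n+1) l = l x^(n+1) + (n+1) l x^n l,
    an induction on n (comm_expr_int), followed by a division by n+1: this is
    where the characteristic matters (rota_baxter_horner).  Hence the ring of
    operators has the same universal property (diff_rb_ops_lift).

    The two universal properties yield ring morphisms in both directions that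
    exchange the generators; they are mutually inverse since a morphism out of
    either algebra is determined by its values on generators.  The ring of
    operators is not known beforehand to be nontrivial, so morphisms into it
    are built as ring morphisms, and linearity is deduced at the end from their
    values on scalars. *)

(** * Consequences of the relations between x, d and l *)

Lemma poly_rmorph_ext (R : nzSemiRingType) (C : pzSemiRingType)
    (f g : {rmorphism {poly R} -> C}) :
  (forall c, f c%:P = g c%:P) -> f 'X = g 'X -> f =1 g.
Proof.
move=> fgC fgX; elim/poly_ind=> [|p c IHp]; first by rewrite !rmorph0.
by rewrite !rmorphD !rmorphM IHp fgC fgX.
Qed.

Section PolynomialIdentities.
Variables (k : fieldType) (C : algType k) (x : C).

Lemma comm_hornerM (d : C) p :
  d * x = x * d + 1 ->
  d * horner_alg x p = horner_alg x p * d + horner_alg x p^`().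
Proof.
move=> dx; elim/poly_ind: p => [|p c IHp].
  by rewrite deriv0 !rmorph0 mulr0 mul0r addr0.
rewrite derivD derivM derivX derivC addr0 mulr1.
rewrite !rmorphD !rmorphM /= horner_algX horner_algC.
set q := horner_alg x p in IHp *; set q' := horner_alg x _ in IHp *.
rewrite mulrDr mulrA IHp !mulrDl -(mulrA q d x) dx.
rewrite mulrDr mulr1 mulr_algl mulr_algr mulrA.
by rewrite -!addrA; congr (_ + _); rewrite [RHS]addrC -addrA addrCA.
Qed.

(** The induction step moves one x past l: it turns
    x (l x^(n+1) + (n+1) l x^n l) into l x^(n+2) + (n+1) l x^(n+1) l plus
    l (l x^(n+1) + (n+1) l x^n l), and the latter is l x^(n+1) l by
    induction. *)
Lemma comm_expr_int (l : C) n :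
  x * l = l * x + l ^+ 2 ->
  x ^+ n.+1 * l = l * x ^+ n.+1 + (l * x ^+ n * l) *+ n.+1.
Proof.
move=> xl; elim: n => [|n IHn].
  by rewrite expr0 !expr1 mulr1 mulr1n xl expr2.
have xlM y : x * (l * y) = l * (x * y) + l * (l * y).
  by rewrite !mulrA xl mulrDl expr2.
rewrite exprS -mulrA IHn mulrDr mulrnAr -(mulrA l _ l) !xlM mulrnDl.
rewrite !mulrA -(mulrA l x) -exprS -(mulrA l _ l) -addrA; congr (_ + _).
rewrite addrCA [RHS]mulrSr; congr (_ + _); first by rewrite exprS !mulrA.
by rewrite IHn mulrDr mulrnAr !mulrA.
Qed.

Lemma rota_baxter_horner (l : C) p :
  [pchar k] =i pred0 -> x * l = l * x + l ^+ 2 ->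
  l * horner_alg x p * l
  = horner_alg x (rota_baxter p) * l - l * horner_alg x (rota_baxter p).
Proof.
move=> /pcharf0P char0 xl; rewrite /rota_baxter -{1}[p]coefK poly_def.
rewrite !raddf_sum /= mulr_sumr !mulr_suml mulr_sumr -sumrB.
apply: eq_bigr => i _; rewrite !linearZ /= !rmorphXn /= horner_algX.
rewrite !mulr_algl -!scalerAl -!scalerAr -scalerAl -scalerBr.
rewrite comm_expr_int // addrC addKr.
by rewrite -scaler_nat scalerA divfK // char0.
Qed.
End PolynomialIdentities.

(** * Morphisms out of quotients, skew polynomial rings and free products *)

Section QuotientLift.
Variables (k : pzRingType) (A : algType k) (P : A -> Prop).

Lemma qpi_rel u v : P (u - v) -> qpi P u = qpi P v.
Proof.
move=> Puv; apply/qpi_eq; rewrite -[u - v]mul1r -[_ * _]mulr1.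
exact: ideal_gen_mul.
Qed.

Lemma quot_alg_lift (C : pzRingType) (f : {rmorphism A -> C}) :
  (forall r, P r -> f r = 0) ->
  exists g : {rmorphism quot_alg P -> C}, forall u, g (qpi P u) = f u.
Proof.
move=> fP; pose g (x : quot_alg P) := f (repr x).
have fI u : ideal_gen P u -> f u = 0.
  elim=> [|v w _ fv _ fw|a r b /fP fr]; first exact: rmorph0.
    by rewrite rmorphD fv fw addr0.
  by rewrite !rmorphM fr mulr0 mul0r.
have gE u : g (qpi P u) = f u.
  by apply/eqP; rewrite -subr_eq0 -rmorphB fI //; apply: repr_qpi.
have gB : zmod_morphism g.
  by elim/qpi_ind=> u; elim/qpi_ind=> v; rewrite -rmorphB !gE rmorphB.
have gM : monoid_morphism g.
  split; first by rewrite -(rmorph1 (qpi P)) gE rmorph1.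
  by elim/qpi_ind=> u; elim/qpi_ind=> v; rewrite -rmorphM !gE rmorphM.
pose addM := GRing.isZmodMorphism.Build _ _ g gB.
pose mulM := GRing.isMonoidMorphism.Build _ _ g gM.
pose h : {rmorphism quot_alg P -> C} := HB.pack g addM mulM.
by exists h.
Qed.

Lemma quot_alg_scalar_comm c (x : quot_alg P) :
  x * (c *: (1 : quot_alg P)) = c *: (1 : quot_alg P) * x.
Proof. by rewrite -quot_scalerAr -quot_scalerAl mulr1 mul1r. Qed.
End QuotientLift.

Section SkewLift.
Variables (k : pzRingType) (A : algType k) (d : derivation A) (C : pzRingType).

(** The candidate g sends sum_i a_i xi^i to sum_i f(a_i) X^i.  The commutation
    rule says exactly that g turns left multiplication by xi, that is
    skew_shift, into left multiplication by X (gshift); multiplicativity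
    follows since a product is defined by iterating skew_shift. *)
Lemma skew_poly_lift (f : {rmorphism A -> C}) (X : C) :
  (forall a, X * f a = f a * X + f (d a)) ->
  exists g : {rmorphism skew_poly d -> C},
    (forall a, g (skew_const d a) = f a) /\ g (skew_xi d) = X.
Proof.
move=> Xf.
pose g (p : skew_poly d) := \sum_(i < size (p : {poly A})) f p`_i * X ^+ i.
have gE n (p : {poly A}) :
    (size p <= n)%N -> g p = \sum_(i < n) f p`_i * X ^+ i.
  move=> le_pn; rewrite /g (big_ord_widen n (fun i => f p`_i * X ^+ i) le_pn).
  rewrite big_mkcond; apply: eq_bigr => i _.
  by case: ltnP => // /(nth_default 0) ->; rewrite rmorph0 mul0r.
have gB : zmod_morphism g.
  move=> p q; pose n := maxn (size (p - q : {poly A}))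
    (maxn (size (p : {poly A})) (size (q : {poly A}))).
  rewrite !(gE n) /n ?leq_max ?leqnn ?orbT // -sumrB; apply: eq_bigr => i _.
  by rewrite coefB rmorphB mulrBl.
pose addM := GRing.isZmodMorphism.Build _ _ g gB.
pose h : {additive skew_poly d -> C} := HB.pack g addM.
have gD p q : g (p + q) = g p + g q by exact: (raddfD h).
have gZ a p : g (a *: (p : {poly A})) = f a * g p.
  rewrite (gE (size (p : {poly A}))) ?size_scale_leq // mulr_sumr.
  by apply: eq_bigr => i _; rewrite coefZ rmorphM mulrA.
have gshift p : g (skew_shift d p) = X * g p.
  rewrite /skew_shift gD.
  rewrite (gE (size (p : {poly A})).+1 (_ * 'X)); last first.
    by case: (eqVneq p 0) => [->|p0]; rewrite ?mul0r ?size_poly0 ?size_mulX.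
  rewrite (gE (size (p : {poly A})) (map_poly d p)) ?size_poly //.
  rewrite big_ord_recl coefMX rmorph0 mul0r add0r mulr_sumr -big_split.
  apply: eq_bigr => i _; rewrite coefMX /= coef_map_id0 ?linear0 //.
  by rewrite mulrA Xf mulrDl exprS mulrA.
have gM : monoid_morphism g.
  split=> [|p q].
    by rewrite [LHS](gE 1%N) ?size_poly1 // big_ord1 coefC rmorph1 mulr1.
  rewrite [_ * q]/(skew_mul p q) /skew_mul [LHS](raddf_sum h) mulr_suml.
  apply: eq_bigr => i _; rewrite [LHS]gZ -mulrA; congr (_ * _).
  elim: {i}(i : nat) => [|i IHi] /=; first by rewrite mul1r.
  by rewrite gshift IHi exprS mulrA.
pose mulM := GRing.isMonoidMorphism.Build _ _ g gM.
pose h' : {rmorphism skew_poly d -> C} := HB.pack g addM mulM.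
exists h'; split=> [a|] /=.
  by rewrite (gE 1%N) ?size_polyC_leq1 // big_ord1 coefC mulr1.
rewrite (gE 2) ?size_polyX // !big_ord_recr big_ord0 /= !coefX.
by rewrite rmorph0 rmorph1 mul0r !add0r mul1r.
Qed.

Lemma skew_poly_ext (f g : {rmorphism skew_poly d -> C}) :
  (forall a, f (skew_const d a) = g (skew_const d a)) ->
  f (skew_xi d) = g (skew_xi d) -> f =1 g.
Proof.
move=> fgA fgX p; rewrite [p]skew_polyE !rmorph_sum; apply: eq_bigr => i _.
by rewrite !rmorphM !rmorphXn [f (skew_const _ _)]fgA fgX.
Qed.
End SkewLift.

Section FreeProductLift.
Variables (k : comNzRingType) (A B : algType k).
Local Notation inA := (@free_prod_inl k A B).
Local Notation inB := (@free_prod_inr k A B).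

Lemma free_prod_inl_is_linear : linear inA.
Proof. by move=> c a a'; rewrite -linearP; apply/qpi_rel/FreeProdLinl. Qed.

Lemma free_prod_inl_is_monoid_morphism : monoid_morphism inA.
Proof.
split=> [|a a']; first by rewrite -(rmorph1 (qpi _)); apply/qpi_rel/FreeProd1l.
by rewrite -rmorphM; apply/qpi_rel/FreeProdMull.
Qed.

Lemma free_prod_inr_is_linear : linear inB.
Proof. by move=> c b b'; rewrite -linearP; apply/qpi_rel/FreeProdLinr. Qed.

Lemma free_prod_inr_is_monoid_morphism : monoid_morphism inB.
Proof.
split=> [|b b']; first by rewrite -(rmorph1 (qpi _)); apply/qpi_rel/FreeProd1r.
by rewrite -rmorphM; apply/qpi_rel/FreeProdMulr.
Qed.

HB.instance Definition _ := GRing.isLinear.Build k A (free_prod A B) *:%R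
  inA free_prod_inl_is_linear.
HB.instance Definition _ := GRing.isMonoidMorphism.Build A (free_prod A B)
  inA free_prod_inl_is_monoid_morphism.
HB.instance Definition _ := GRing.isLinear.Build k B (free_prod A B) *:%R
  inB free_prod_inr_is_linear.
HB.instance Definition _ := GRing.isMonoidMorphism.Build B (free_prod A B)
  inB free_prod_inr_is_monoid_morphism.

Lemma free_prod_inl_scalar (c : k) : inA c%:A = c *: (1 : free_prod A B).
Proof. by rewrite linearZ /= rmorph1. Qed.

Lemma free_prod_inr_scalar (c : k) : inB c%:A = c *: (1 : free_prod A B).
Proof. by rewrite linearZ /= rmorph1. Qed.

(** Linearity of f and g is a separate hypothesis on ring morphisms, because
    horner_alg is canonically linear for the action of k through its embedding
    in C, which coincides with the scaling of C only propositionally. *)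
Lemma free_prod_lift (C : algType k)
    (f : {rmorphism A -> C}) (g : {rmorphism B -> C}) :
    scalable f -> scalable g ->
  exists h : {rmorphism free_prod A B -> C},
    (forall a, h (inA a) = f a) /\ (forall b, h (inB b) = g b).
Proof.
move=> fZ gZ.
pose h0 (s : A + B) := match s with inl a => f a | inr b => g b end.
pose h : {rmorphism free_alg k _ -> C} := free_lift h0.
have hG s : h (free_gen k s) = h0 s by exact: free_lift_gen.
have hP c u v : h (c *: u + v) = c *: h u + h v by exact: free_lift_linear.
have fP c u v : f (c *: u + v) = c *: f u + f v by rewrite rmorphD fZ.
have gP c u v : g (c *: u + v) = c *: g u + g v by rewrite rmorphD gZ.
have [r|h' h'E] := @quot_alg_lift _ _ (@free_prod_rel k A B) _ h; last first.
  by exists h'; split=> [a|b]; rewrite h'E hG.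
case=> [c a a'|a a'||c b b'|b b'|]; rewrite rmorphB.
- by rewrite hP !hG /= fP subrr.
- by rewrite rmorphM !hG /= rmorphM subrr.
- by rewrite hG rmorph1 /= rmorph1 subrr.
- by rewrite hP !hG /= gP subrr.
- by rewrite rmorphM !hG /= rmorphM subrr.
- by rewrite hG rmorph1 /= rmorph1 subrr.
Qed.

Lemma free_prod_ext (C : pzRingType) (f g : {rmorphism free_prod A B -> C}) :
  (forall a, f (inA a) = g (inA a)) -> (forall b, f (inB b) = g (inB b)) ->
  f =1 g.
Proof.
move=> fgA fgB; elim/qpi_ind; elim/free_ind=> [|c u v IHu IHv|s].
- by rewrite !rmorph0.
- (* f and g need not be linear, but scalars are in the image of A *)
  have -> : c *: u + v = c%:A * u + v by rewrite mulr_algl.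
  have cE : qpi (@free_prod_rel k A B) c%:A = inA c%:A.
    by rewrite [RHS]linearZ [LHS]linearZ /= !rmorph1.
  rewrite !rmorphD !rmorphM IHu IHv; congr (_ * _ + _).
  by have := fgA c%:A; rewrite -cE.
elim: s => [|x s IHs]; first by rewrite free_word_nil !rmorph1.
rewrite free_word_cons !rmorphM IHs; congr (_ * _).
by case: x => [a|b]; [exact: fgA|exact: fgB].
Qed.
End FreeProductLift.

(** * The universal property of the integro-differential Weyl algebra *)

Section WeylLift.
Variables (k : comNzRingType) (C : pzRingType).
Local Notation D := (free_gen k (ord0 : 'I_2)).
Local Notation L := (free_gen k (ord_max : 'I_2)).

(** C carries no k-action, so the first hypothesis replaces the requirement
    that scalars be central. *)
Lemma int_diff_weyl_lift (w : {rmorphism free_alg k 'I_2 -> C}) (X : C) :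
    (forall c, X * w c%:A = w c%:A * X) ->
    w D * w L = 1 -> w D * X = X * w D + 1 -> X * w L = w L * X + w L ^+ 2 ->
  exists g : {rmorphism int_diff_weyl k -> C},
    (forall u, g (skew_const (delta k) (qpi (@int_diff_rel k) u)) = w u)
    /\ g (skew_xi (delta k)) = X.
Proof.
move=> Xc DL DX XL.
have [r [] {r}|theta thetaE] := @quot_alg_lift _ _ (@int_diff_rel k) _ w.
  by rewrite rmorphB rmorphM rmorph1 DL subrr.
(* commutation with X defines a derivation, so it can be checked on D and L *)
have Xw u : X * w u = w u * X + w (free_delta u).
  have wP c y z : w (c *: y + z) = w c%:A * w y + w z.
    by rewrite rmorphD -(mulr_algl c y) rmorphM.
  elim/free_ind: u => [|c u v IHu IHv|s].
  - by rewrite [free_delta 0]linear0 !rmorph0 mulr0 mul0r addr0.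
  - rewrite [free_delta _]linearP /= !wP mulrDr IHv mulrA Xc -mulrA IHu.
    by rewrite mulrDr mulrDl !mulrA addrACA.
  elim: s => [|i s IHs].
    rewrite free_word_nil rmorph1 mulr1 mul1r -free_word_nil.
    by rewrite [free_delta _]free_der_word /= rmorph0 addr0.
  have Xi : X * w (free_gen k i)
      = w (free_gen k i) * X + w (free_delta (free_gen k i)).
    rewrite [free_delta _]free_der_gen; case: (eqVneq i ord0) => [->|i0].
      by rewrite DX rmorphN rmorph1 addrK.
    have -> : i = ord_max by apply/val_inj; case: i i0 => [[|[]]].
    by rewrite XL rmorphXn.
  rewrite free_word_cons [free_delta _]free_der_leibniz -!/(free_delta _).
  rewrite rmorphD !rmorphM mulrA Xi mulrDl -mulrA IHs mulrDr !mulrA.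
  by rewrite -!addrA; congr (_ + _); rewrite addrC.
have Xtheta a : X * theta a = theta a * X + theta (delta k a).
  elim/qpi_ind: a => u; rewrite thetaE Xw; congr (_ + _).
  by rewrite [delta k _]delta_qpi thetaE.
have [g [gc gX]] := @skew_poly_lift _ _ (delta k) C theta X Xtheta.
by exists g; split=> // u; rewrite -thetaE -gc.
Qed.
End WeylLift.

Section WeylRelations.
Variable k : fieldType.
Local Notation W := (int_diff_weyl k).
Local Notation D := (free_gen k (ord0 : 'I_2)).
Local Notation L := (free_gen k (ord_max : 'I_2)).
Local Notation xi := (skew_xi (delta k) : W).

Lemma int_diff_weyl_relations :
  exists w : {lrmorphism free_alg k 'I_2 -> W},
    [/\ forall u, w u = skew_const (delta k) (qpi (@int_diff_rel k) u),
        w D * w L = 1, w D * xi = xi * w D + 1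
      & xi * w L = w L * xi + w L ^+ 2].
Proof.
pose const : {lrmorphism int_diff_alg k -> W} := skew_const (delta k).
pose w : {lrmorphism free_alg k 'I_2 -> W} :=
  const \o (qpi (@int_diff_rel k) : _ -> int_diff_alg k).
have xi_const a : xi * const a = const a * xi + const (delta k a).
  exact: skew_xi_const.
exists w; split=> [//|||].
- by have := congr1 const (partial_ell k); rewrite rmorphM rmorph1.
- have := xi_const (partial k); rewrite delta_partial rmorphN rmorph1 => ->.
  by rewrite addrNK.
- by have := xi_const (ell k); rewrite delta_ell rmorphXn.
Qed.
End WeylRelations.

(** * The ring of differential Rota-Baxter operators *)

Section DiffRBOperators.
Variable k : fieldType.
Local Notation rb := (qpi (@diff_rb_rel k)).
Local Notation pol :=
  (@free_prod_inl k {poly k} (free_alg k 'I_2) : _ -> rb_free_prod k).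
Local Notation wrd :=
  (@free_prod_inr k {poly k} (free_alg k 'I_2) : _ -> rb_free_prod k).
Local Notation D := (free_gen k (ord0 : 'I_2)).
Local Notation L := (free_gen k (ord_max : 'I_2)).

Lemma rb_der_int : rb (wrd D) * rb (wrd L) = 1.
Proof.
have E : rb (wrd D * wrd L) = rb 1 by apply/qpi_rel/DiffRBSection.
by rewrite -(rmorph1 rb) -[LHS](rmorphM rb).
Qed.

Lemma rb_der_polX : rb (wrd D) * rb (pol 'X) = rb (pol 'X) * rb (wrd D) + 1.
Proof.
have E : rb (wrd D * pol 'X) = rb (pol 'X * wrd D + 1).
  apply: qpi_rel; rewrite opprD addrA.
  have := DiffRBLeibniz ('X : {poly k}); rewrite derivX.
  have -> : free_prod_inl (free_alg k 'I_2) (1 : {poly k}) = 1.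
    exact: rmorph1.
  by [].
rewrite -(rmorph1 rb) -[LHS](rmorphM rb) -[X in X + _](rmorphM rb).
by rewrite -[RHS](rmorphD rb).
Qed.

Lemma rb_polX_int :
  rb (pol 'X) * rb (wrd L) = rb (wrd L) * rb (pol 'X) + rb (wrd L) ^+ 2.
Proof.
have rb1 : rota_baxter (1 : {poly k}) = 'X.
  by rewrite /rota_baxter size_poly1 big_ord1 coefC eqxx divr1 scale1r expr1.
have E : rb (wrd L * pol 'X + wrd L * wrd L) = rb (pol 'X * wrd L).
  have reorder (a b c : rb_free_prod k) : a * 1 * a - b + c = c + a * a - b.
    by rewrite mulr1 addrC addrA.
  apply: qpi_rel; have := DiffRBRotaBaxter (1 : {poly k}); rewrite rb1.
  have -> : free_prod_inl (free_alg k 'I_2) (1 : {poly k}) = 1.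
    exact: rmorph1.
  by rewrite reorder.
rewrite expr2 -[LHS](rmorphM rb) -[X in X + _](rmorphM rb).
by rewrite -[X in _ + X](rmorphM rb) -[RHS](rmorphD rb).
Qed.

Lemma rb_pol_scalar (c : k) : rb (pol c%:P) = c *: (1 : diff_rb_ops k).
Proof.
have -> : pol c%:P = c *: (1 : rb_free_prod k).
  by rewrite -alg_polyC; exact: free_prod_inl_scalar.
by rewrite [LHS]linearZ; congr (_ *: _); exact: (rmorph1 rb).
Qed.

Lemma rb_wrd_scalar (c : k) : rb (wrd c%:A) = c *: (1 : diff_rb_ops k).
Proof.
have -> : wrd c%:A = c *: (1 : rb_free_prod k) by exact: free_prod_inr_scalar.
by rewrite [LHS]linearZ; congr (_ *: _); exact: (rmorph1 rb).
Qed.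

(** The morphism has to be prescribed on k[x] and on k<d, l>; since k[x] is free
    on x, the relations of x with d and l are enough for the whole families of
    Leibniz and Rota-Baxter relators to vanish. *)
Lemma diff_rb_ops_lift (C : algType k)
    (w : {lrmorphism free_alg k 'I_2 -> C}) (x : C) :
    [pchar k] =i pred0 ->
    w D * w L = 1 -> w D * x = x * w D + 1 -> x * w L = w L * x + w L ^+ 2 ->
  exists g : {rmorphism diff_rb_ops k -> C},
    (forall f, g (rb (pol f)) = horner_alg x f) /\
    (forall u, g (rb (wrd u)) = w u).
Proof.
move=> char0 DL Dx xL.
have hornerZ : scalable (horner_alg x).
  by move=> c f; rewrite -mul_polyC rmorphM /= horner_algC mulr_algl.
have wZ : scalable w by move=> c u; exact: linearZ.
have [h [hp hw]] := @free_prod_lift _ _ _ _ (horner_alg x) w hornerZ wZ.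
have [r|g gE] := @quot_alg_lift _ _ (@diff_rb_rel k) _ h; last first.
  by exists g; split=> [f|u]; [rewrite -hp -gE|rewrite -[RHS]hw -gE].
(* The three shapes of relators are evaluated for abstract a, b and c: on the
   concrete generators, unification would compare the two inclusions into the
   free product by unfolding them. *)
have hLeibniz a b c a' b' c' : h a = a' -> h b = b' -> h c = c' ->
    h (a * b - b * a - c) = a' * b' - b' * a' - c'.
  by move=> <- <- <-; rewrite !rmorphB !rmorphM.
have hRotaBaxter a b c a' b' c' : h a = a' -> h b = b' -> h c = c' ->
    h (a * b * a - c * a + a * c) = a' * b' * a' - c' * a' + a' * c'.
  by move=> <- <- <-; rewrite rmorphD rmorphB !rmorphM.
have hSection a b a' b' : h a = a' -> h b = b' -> h (a * b - 1) = a' * b' - 1.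
  by move=> <- <-; rewrite rmorphB rmorphM rmorph1.
case=> [f|f|].
- rewrite [LHS](hLeibniz _ _ _ _ _ _ (hw D) (hp f) (hp f^`())).
  by rewrite (comm_hornerM _ _ _ _ _ Dx) addrAC addrK subrr.
- rewrite [LHS](hRotaBaxter _ _ _ _ _ _ (hw L) (hp f) (hp (rota_baxter f))).
  rewrite (rota_baxter_horner _ _ _ _ _ char0 xL).
  by rewrite addrAC subrK subrr.
by rewrite [LHS](hSection _ _ _ _ (hw D) (hw L)) DL subrr.
Qed.
End DiffRBOperators.

(** * The isomorphism *)

Theorem corollary5p4 (k : fieldType) (char0 : [pchar k] =i pred0) :
  exists f : {lrmorphism int_diff_weyl k -> diff_rb_ops k}, bijective f.
Proof.
pose rb := qpi (@diff_rb_rel k).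
pose pol : {poly k} -> rb_free_prod k := free_prod_inl (free_alg k 'I_2).
pose wrd : free_alg k 'I_2 -> rb_free_prod k := @free_prod_inr _ {poly k} _.
have [w [wE DL Dx xL]] := int_diff_weyl_relations k.
have [psi [psi_pol psi_wrd]] := diff_rb_ops_lift _ _ _ _ char0 DL Dx xL.
pose v : {rmorphism free_alg k 'I_2 -> diff_rb_ops k} := rb \o wrd.
have central c : rb (pol 'X) * v c%:A = v c%:A * rb (pol 'X).
  have -> : v c%:A = c *: (1 : diff_rb_ops k) by exact: rb_wrd_scalar.
  exact: quot_alg_scalar_comm.
have [phi [phi_const phi_xi]] := int_diff_weyl_lift _ _ v _ central
  (rb_der_int k) (rb_der_polX k) (rb_polX_int k).
have phi_scalar c : phi c%:A = c *: (1 : diff_rb_ops k).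
  have <- : w c%:A = c%:A by rewrite linearZ /= rmorph1.
  by rewrite wE phi_const; exact: rb_wrd_scalar.
have phiZ : scalable phi.
  move=> c a; rewrite -(mulr_algl c a) rmorphM phi_scalar.
  by rewrite -[LHS]quot_scalerAl mul1r.
have phi_horner f : phi (horner_alg (skew_xi (delta k)) f) = rb (pol f).
  apply: (poly_rmorph_ext _ _ (phi \o horner_alg (skew_xi (delta k)))
    (rb \o pol)) => [c|] /=.
    by rewrite horner_algC phi_scalar; symmetry; exact: rb_pol_scalar.
  by rewrite horner_algX phi_xi.
have phiK : cancel phi psi.
  apply: (skew_poly_ext _ _ _ _ (psi \o phi) idfun) => [a|] /=; last first.
    by rewrite phi_xi psi_pol horner_algX.
  elim/qpi_ind: a => u; rewrite phi_const.
  exact: etrans (psi_wrd u) (wE u).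
have psiK : cancel psi phi.
  pose F : {rmorphism rb_free_prod k -> diff_rb_ops k} := phi \o psi \o rb.
  pose G : {rmorphism rb_free_prod k -> diff_rb_ops k} := rb.
  have FG : F =1 G.
    apply: (@free_prod_ext _ _ _ _ F G) => [f|u].
      exact: etrans (congr1 phi (psi_pol f)) (phi_horner f).
    exact: etrans (congr1 phi (etrans (psi_wrd u) (wE u))) (phi_const u).
  by elim/qpi_ind=> u; exact: FG.
pose phi0 : int_diff_weyl k -> diff_rb_ops k := phi.
have phi0B : zmod_morphism phi0 by exact: raddfB.
have phi0M : monoid_morphism phi0 by split; [exact: rmorph1|exact: rmorphM].
pose addM := GRing.isZmodMorphism.Build _ _ phi0 phi0B.
pose mulM := GRing.isMonoidMorphism.Build _ _ phi0 phi0M.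
pose scaleM := GRing.isScalable.Build _ _ _ _ phi0 phiZ.
pose Phi : {lrmorphism int_diff_weyl k -> diff_rb_ops k} :=
  HB.pack phi0 addM mulM scaleM.
by exists Phi; exists psi.
Qed.
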